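(* Let $E$ be a nonzero reflexive real Banach space, let $f,g\colon E\times E^*\to\,]{-}\infty,\infty]$ be proper convex lower semicontinuous BC--functions, and let $w^*\in E^*$ be such that $E\times\{w^*\}\subset\mathrm{dom}\,f$ and $\pi_2\,\mathrm{dom}\,g=E^*$. Then: (a) ${\cal P}_q(f)+\rho_1{\cal P}_q(g)=E\times E^*$ and ${\cal P}_q(f)-\rho_1{\cal P}_q(g)=E\times E^*$; (b) for every $x\in E$ there exist $(y,y^* )\in{\cal P}_q(f)$ and $(z,y^* )\in{\cal P}_q(g)$ with $y+z=x$; (c) for every $x^*\in E^*$ there exist $(y,y^* )\in{\cal P}_q(f)$ and $(y,z^* )\in{\cal P}_q(g)$ with $y^*+z^*=x^*$.
   Context: $\rho_1(x,x^* ):=(-x,x^* )$, $\pi_2(x,x^* ):=x^*$, $\mathrm{dom}\,f:=\{(x,x^* )\colon f(x,x^* )\in\mathbb{R}\}$. On $E\times E^*$ set $\lfloor(x,x^* ),(y,y^* )\rfloor:=\langle x,y^*\rangle+\langle y,x^*\rangle$ and $q(x,x^* ):=\langle x,x^*\rangle$. For $k$ on $E\times E^*$, $k^@(y,y^* ):=\sup_{(x,x^* )}[\lfloor(x,x^* ),(y,y^* )\rfloor-k(x,x^* )]$; a BC--function is a proper convex $k$ with $k^@\ge k\ge q$; ${\cal P}_q(k):=\{(x,x^* )\colon k(x,x^* )=\langle x,x^*\rangle\}$. *)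

(* Defs.v *)
From HB Require Import structures.
From mathcomp Require Import all_boot all_order all_algebra.
From mathcomp Require Import all_classical all_reals all_analysis.
Set Implicit Arguments. Unset Strict Implicit. Unset Printing Implicit Defensive.
Import Order.TTheory GRing.Theory Num.Theory.
Import numFieldNormedType.Exports.
Local Open Scope classical_set_scope.
Local Open Scope ring_scope.

(* Elements of the dual E^* are represented as functions E -> R that are
   linear and (norm-)continuous. *)
Definition in_dual (R : realType) (E : normedModType R) (phi : E -> R) : Prop :=
  (forall (a : R) (x y : E), phi (a *: x + y) = a * phi x + phi y) /\ continuous phi.

Definition dnorm (R : realType) (E : normedModType R) (phi : E -> R) : R :=
  sup [set `|phi x| | x in [set x : E | `|x| <= 1]].

Definition pdist (R : realType) (E : normedModType R)
  (x : E) (phi : E -> R) (y : E) (psi : E -> R) : R :=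
  `|x - y| + dnorm (fun u => phi u - psi u).

Definition lsc (R : realType) (E : normedModType R) (k : E -> (E -> R) -> \bar R) : Prop :=
  forall (x : E) (phi : E -> R), in_dual phi ->
  forall a : R, (a%:E < k x phi)%E ->
  exists2 e : R, 0 < e & forall (y : E) (psi : E -> R), in_dual psi ->
    pdist x phi y psi < e -> (a%:E < k y psi)%E.

Definition proper_fun (R : realType) (E : normedModType R) (k : E -> (E -> R) -> \bar R) : Prop :=
  (exists (x : E) (phi : E -> R), in_dual phi /\ (k x phi < +oo)%E) /\
  (forall (x : E) (phi : E -> R), in_dual phi -> (-oo < k x phi)%E).

Definition convex_fun (R : realType) (E : normedModType R) (k : E -> (E -> R) -> \bar R) : Prop :=
  forall (x y : E) (phi psi : E -> R) (t : R), in_dual phi -> in_dual psi ->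
    0 < t < 1 ->
    (k (t *: x + (1 - t) *: y)%R (fun u => t * phi u + (1 - t) * psi u)%R
      <= t%:E * k x phi + (1 - t)%R%:E * k y psi)%E.

Definition fat (R : realType) (E : normedModType R) (k : E -> (E -> R) -> \bar R)
  (y : E) (psi : E -> R) : \bar R :=
  ereal_sup [set z | exists (x : E) (phi : E -> R),
     in_dual phi /\ z = ((psi x + phi y)%:E - k x phi)%E].

Definition BC (R : realType) (E : normedModType R) (k : E -> (E -> R) -> \bar R) : Prop :=
  proper_fun k /\ convex_fun k /\
  (forall (x : E) (phi : E -> R), in_dual phi ->
     ((phi x)%:E <= k x phi)%E /\ (k x phi <= fat k x phi)%E).

Definition Pq (R : realType) (E : normedModType R) (k : E -> (E -> R) -> \bar R)
  (x : E) (phi : E -> R) : Prop :=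
  in_dual phi /\ k x phi = (phi x)%:E.

Definition reflexive_space (R : realType) (E : normedModType R) : Prop :=
  forall Phi : (E -> R) -> R,
    (forall (a : R) (phi psi : E -> R), in_dual phi -> in_dual psi ->
       Phi (fun u => a * phi u + psi u) = a * Phi phi + Phi psi) ->
    (forall phi, in_dual phi -> forall e : R, 0 < e ->
       exists2 d : R, 0 < d & forall psi, in_dual psi ->
         dnorm (fun u => psi u - phi u) < d -> `|Phi psi - Phi phi| < e) ->
    exists x : E, forall phi, in_dual phi -> Phi phi = phi x.

(* Main.v *)
Require Import Defs.
From HB Require Import structures.
From mathcomp Require Import all_boot all_order all_algebra.
From mathcomp Require Import all_classical all_reals all_analysis.
From mathcomp Require Import ring lra.
Set Implicit Arguments.
Unset Strict Implicit.
Unset Printing Implicit Defensive.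
Import Order.TTheory GRing.Theory Num.Theory.
Import numFieldNormedType.Exports.
Local Open Scope ring_scope.
Local Open Scope classical_set_scope.

(** After an affine change of variables on [g] that preserves BC-functions, it
    suffices to find [(y, psi)] in [P_q f] with [(y, - psi)] in [P_q g].  Since
    [f, g >= q], the sum of [F (y, psi) = f (y, psi)] and
    [G (y, psi) = g (y, - psi)] is nonnegative, and the domain hypotheses say
    that [dom F - dom G] is the whole of [E * E^*].  The Attouch-Brezis theorem
    gives a continuous linear [zeta] with [zeta (p - q) <= F p + G q]; by
    reflexivity [zeta = (a, x0)], and the inequality becomes
    [f^@ (x0, a) + g^@ (x0, - a) <= 0].  As [f^@ >= f >= q], and likewise for
    [g], both functions agree with [q] at these points.

    The linear minorant of the marginal function [x |-> inf_z H (z, x)] exists by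
    Hahn-Banach; it is continuous because, by Baire's theorem and completeness,
    the sublevel sets of [H] project onto sets containing a ball. *)

(** * Hahn-Banach for sublinear functionals *)

Section HahnBanach.
Context {R : realType} {V : lmodType R}.
Implicit Types k p : V -> R.

(* One inequality for both subadditivity and positive homogeneity. *)
Definition sublinear k := forall a b x y, 0 < a -> 0 < b ->
  k (a *: x + b *: y) <= a * k x + b * k y.

Lemma sublinear0 k : sublinear k -> k 0 = 0.
Proof.
move=> ks.
have := ks 1 1 0 0 ltr01 ltr01; rewrite !scaler0 addr0 => k0.
have := ks (1/4) (1/4) 0 0; rewrite !scaler0 addr0 => /(_ _)/(_ _) k1.
have {}k1 := k1 ltac:(lra) ltac:(lra).
by apply/eqP; rewrite eq_le; apply/andP; split; lra.
Qed.

Lemma sublinearD k x y : sublinear k -> k (x + y) <= k x + k y.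
Proof.
by move=> /(_ 1 1 x y ltr01 ltr01); rewrite !scale1r !mul1r.
Qed.

Lemma sublinearZ k a x : sublinear k -> 0 <= a -> k (a *: x) = a * k x.
Proof.
move=> ks; rewrite le_eqVlt => /predU1P[<-|a0].
  by rewrite scale0r sublinear0 ?mul0r.
have leZ b y : 0 < b -> k (b *: y) <= b * k y.
  move=> b0; have := ks b b y 0 b0 b0.
  by rewrite scaler0 addr0 (sublinear0 ks) mulr0 addr0.
apply/eqP; rewrite eq_le leZ//=.
have := leZ a^-1 (a *: x); rewrite invr_gt0 scalerA mulVf ?gt_eqF// scale1r => /(_ a0).
by rewrite ler_pdivlMl.
Qed.

Lemma sublinearN k x : sublinear k -> - k (- x) <= k x.
Proof.
by move=> ks; have := sublinearD x (- x) ks; rewrite subrr (sublinear0 ks); lra.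
Qed.

Let below p := {k : V -> R | sublinear k /\ forall x, k x <= p x}.

(** The order is reversed, so that a maximal element from Zorn's lemma is a minimal functional. *)
Let ge_below p (k l : below p) := `[< forall x, sval l x <= sval k x >].

(** Zorn's lemma: the pointwise infimum of a chain of sublinear minorants is again one, and is
    finite because [- p (- x)] bounds every [k x] below. *)
Lemma minimal_sublinear p : sublinear p ->
  exists k, [/\ sublinear k, forall x, k x <= p x &
    forall l, sublinear l -> (forall x, l x <= k x) -> forall x, l x = k x].
Proof.
move=> ps; pose p0 : below p := exist _ p (conj ps (fun x => lexx (p x))).
have [||||k kmax] := @Zorn (below p) (@ge_below p).
- by move=> k; apply/asboolP.
- move=> k l m /asboolP kl /asboolP lm; apply/asboolP => x.
  exact: le_trans (lm x) (kl x).
- move=> [k hk] [l hl] /asboolP /= kl /asboolP /= lk.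
  have kl_eq : k = l by apply/funext => x; apply/eqP; rewrite eq_le kl lk.
  by subst l; congr exist; exact: Prop_irrelevance.
- move=> A Atot.
  have [->|/set0P[a Aa]] := eqVneq A set0; first by exists p0.
  pose S x := [set sval k x | k in A].
  have Slb x : has_inf (S x).
    split; first by exists (sval a x), a.
    exists (- p (- x)) => _ [k Ak <-].
    case: k {Ak} => k [ks kp] /=; apply: le_trans (sublinearN x ks).
    by rewrite lerN2.
  have infS (k : below p) x : A k -> inf (S x) <= sval k x.
    by move=> Ak; apply: ge_inf; [have [] := Slb x|exists k].
  have qs : sublinear (fun x => inf (S x)).
    move=> b c x y b0 c0.
    suff le_q (k l : below p) : A k -> A l ->
        inf (S (b *: x + c *: y)) <= b * sval k x + c * sval l y.
      rewrite -lerBlDr -ler_pdivrMl//; apply: lb_le_inf.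
        by have [] := Slb x.
      move=> _ [k Ak <-]; rewrite ler_pdivrMl// lerBlDr -lerBlDl.
      rewrite -ler_pdivrMl//; apply: lb_le_inf; first by have [] := Slb y.
      move=> _ [l Al <-]; rewrite ler_pdivrMl// lerBlDl; exact: le_q.
    move=> Ak Al.
    (* Of two members of the chain, the smaller one serves both terms. *)
    have [/asboolP kl|/asboolP lk] := Atot _ _ Ak Al.
    - apply: le_trans (infS l _ Al) _; have [ls _] := svalP l.
      apply: le_trans (ls b c x y b0 c0) _.
      by rewrite lerD2r ler_pM2l.
    - apply: le_trans (infS k _ Ak) _; have [ks _] := svalP k.
      apply: le_trans (ks b c x y b0 c0) _.
      by rewrite lerD2l ler_pM2l.
  have qp x : inf (S x) <= p x.
    by apply: le_trans (infS a x Aa) _; have [_] := svalP a; exact.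
  pose q : below p := exist _ (fun x => inf (S x)) (conj qs qp).
  exists q => k Ak; apply/asboolP => x /=; exact: infS.
have [ks kp] := svalP k.
exists (sval k); split => // l ls lk.
have lp x : l x <= p x by exact: le_trans (lk x) (kp x).
have := kmax (exist _ l (conj ls lp)).
rewrite /ge_below => /(_ _)/(congr1 sval) /= -> //.
exact/asboolP.
Qed.

(* Minimality against [x |-> inf_(t >= 0) k (x + t a) - t k a] makes [k]
   superadditive. *)
Lemma minimal_sublinear_add k : sublinear k ->
  (forall l, sublinear l -> (forall x, l x <= k x) -> forall x, l x = k x) ->
  forall a x, k (x + a) = k x + k a.
Proof.
move=> ks kmin a x.
pose S x := [set k (x + t *: a) - t * k a | t in [set t | 0 <= t]].
have Slb y : has_inf (S y).
  split; first by exists (k (y + 0 *: a) - 0 * k a), 0 => /=.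
  exists (- k (- y)) => _ [t /= t0 <-].
  have := sublinearD (y + t *: a) (- y) ks.
  by rewrite addrC addKr (sublinearZ _ ks)//; lra.
have infS t y : 0 <= t -> inf (S y) <= k (y + t *: a) - t * k a.
  by move=> t0; apply: ge_inf; [have [] := Slb y|exists t].
have qs : sublinear (fun y => inf (S y)).
  move=> b c y z b0 c0.
  suff le_q s t : 0 <= s -> 0 <= t -> inf (S (b *: y + c *: z)) <=
      b * (k (y + s *: a) - s * k a) + c * (k (z + t *: a) - t * k a).
    rewrite -lerBlDr -ler_pdivrMl//; apply: lb_le_inf.
      by have [] := Slb y.
    move=> _ [s s0 <-]; rewrite ler_pdivrMl// lerBlDr -lerBlDl.
    rewrite -ler_pdivrMl//; apply: lb_le_inf; first by have [] := Slb z.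
    move=> _ [t t0 <-]; rewrite ler_pdivrMl// lerBlDl; exact: le_q.
  move=> s0 t0.
  apply: le_trans (infS (b * s + c * t) _ _) _.
    by rewrite addr_ge0// mulr_ge0// ltW.
  have := ks b c (y + s *: a) (z + t *: a) b0 c0.
  by rewrite !scalerDr !scalerA addrACA -scalerDl; lra.
have qk y : inf (S y) <= k y.
  by have := infS 0 y (lexx 0); rewrite scale0r addr0 mul0r subr0.
apply/eqP; rewrite eq_le sublinearD//=.
(* By minimality the infimum is [k x]; the parameter 1 gives k x <= k (x + a) - k a. *)
have := infS 1 x ler01; rewrite (kmin _ qs qk) scale1r; lra.
Qed.

(** A minimal sublinear minorant is additive, hence odd, hence homogeneous for negative scalars
    too. *)
Theorem Hahn_Banach p : sublinear p ->
  exists f : {linear V -> R^o}, forall x, f x <= p x.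
Proof.
move=> /minimal_sublinear[k [ks kp kmin]].
have kD := minimal_sublinear_add ks kmin.
have kN x : k (- x) = - k x.
  by apply/eqP; rewrite -addr_eq0 addrC -kD subrr sublinear0.
have kL : linear (k : V -> R^o).
  move=> a x y; rewrite kD; congr (_ + _).
  have [a0|a0] := leP 0 a; first exact: sublinearZ.
  have -> : a *: x = - ((- a) *: x) by rewrite scaleNr opprK.
  by rewrite kN sublinearZ ?mulNr ?opprK// oppr_ge0 ltW.
pose f : {linear V -> R^o} := HB.pack (k : V -> R^o) (GRing.isLinear.Build _ _ _ _ _ kL).
by exists f.
Qed.
End HahnBanach.

(** * The Attouch-Brezis theorem *)

Definition econvex (R : realType) (V : lmodType R) (H : V -> \bar R) :=
  forall (x y : V) (t : R), 0 < t < 1 ->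
    (H (t *: x + (1 - t) *: y)%R <= t%:E * H x + (1 - t)%:E * H y)%E.

Lemma econvex_le (R : realType) (V : lmodType R) (H : V -> \bar R) (x y : V)
    (t a b : R) :
  econvex H -> 0 < t < 1 -> (H x <= a%:E)%E -> (H y <= b%:E)%E ->
  (H (t *: x + (1 - t) *: y)%R <= (t * a + (1 - t) * b)%:E)%E.
Proof.
move=> Hc t01 Ha Hb; apply: le_trans (Hc x y t t01) _.
move: t01 => /andP[t0 t1]; rewrite [leRHS]EFinD !EFinM.
by apply: leeD; rewrite lee_pmul2l ?fin_numE ?lte_fin ?subr_gt0.
Qed.

(** With h x = inf_z H (z, x), the infimum of [S x] is that of h (t x) / t over t > 0, the
    positively homogeneous hull of h. It is sublinear, lies below h, and is finite because h < +oo
    and h 0 >= 0; Hahn-Banach applies to it. *)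
Lemma linear_minorant_of_marginal (R : realType) (Z X : lmodType R)
    (H : Z * X -> \bar R) :
  econvex H -> (forall x, exists z, (H (z, x) < +oo)%E) ->
  (forall z, (0 <= H (z, 0%R))%E) ->
  exists f : {linear X -> R^o}, forall z x, ((f x)%:E <= H (z, x))%E.
Proof.
move=> Hc Hdom H0.
pose S (x : X) := [set s : R | exists2 t : R, 0 < t &
  exists z, (H (z, t *: x)%R <= (t * s)%:E)%E].
have S0 s : S 0 s -> 0 <= s.
  move=> [t t0 [z]]; rewrite scaler0 => /(le_trans (H0 z)).
  by rewrite lee_fin pmulr_rge0.
have SH z x s : (H (z, x) <= s%:E)%E -> S x s.
  by move=> Hs; exists 1 => //; exists z; rewrite scale1r mul1r.
have SD a b x y s1 s2 : 0 < a -> 0 < b -> S x s1 -> S y s2 ->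
    S (a *: x + b *: y) (a * s1 + b * s2).
  move=> a0 b0 [t1 t10 [z1 H1]] [t2 t20 [z2 H2]].
  have at0 := divr_gt0 a0 t10; have bt0 := divr_gt0 b0 t20.
  (* The weight [c] is such that c t1 = a / w and (1 - c) t2 = b / w, so [w^-1] is the new scale. *)
  pose w := a / t1 + b / t2; have w0 : 0 < w by rewrite addr_gt0.
  pose c := a / t1 / w; have c01 : 0 < c < 1.
    by rewrite divr_gt0// ltr_pdivrMr// mul1r ltrDl.
  have cE : 1 - c = b / t2 / w.
    by rewrite /c -[X in X - _](@divff _ w) ?gt_eqF// -mulrBl /w addrC addKr.
  exists w^-1; first by rewrite invr_gt0.
  exists (c *: z1 + (1 - c) *: z2).
  have := econvex_le Hc c01 H1 H2.
  rewrite (_ : c *: _ + _ = (c *: z1 + (1 - c) *: z2, w^-1 *: (a *: x + b *: y))).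
    congr (_ <= _)%E; congr (_%:E); rewrite cE /c.
    by rewrite mulrDr; congr (_ + _); field; rewrite ?gt_eqF//.
  congr pair; rewrite /= !scalerA cE /c scalerDr !scalerA.
  by congr (_ *: _ + _ *: _); field; rewrite ?gt_eqF//.
have Sne x : S x !=set0.
  have [z] := Hdom x; case Hzx : (H (z, x)) => [s| |] // _.
    by exists s; apply: (SH z); rewrite Hzx.
  by exists 0; apply: (SH z); rewrite Hzx leNye.
have Sinf x : has_inf (S x).
  (* Adding an element of [S (- x)] to one of [S x] lands in [S 0], which bounds [S x] below. *)
  split => //; have [s' Ss'] := Sne (- x).
  exists (- s') => s Ss; have := SD 1 1 _ _ _ _ ltr01 ltr01 Ss Ss'.
  by rewrite !scale1r !mul1r subrr => /S0; rewrite -lerBlDr sub0r.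
have subl : sublinear (fun x => inf (S x)).
  move=> a b x y a0 b0.
  rewrite -lerBlDr -ler_pdivrMl//; apply: lb_le_inf => // s Ss.
  rewrite ler_pdivrMl// lerBlDr -lerBlDl -ler_pdivrMl//.
  apply: lb_le_inf => // s' Ss'.
  rewrite ler_pdivrMl// lerBlDl; apply: ge_inf; last exact: SD.
  by have [] := Sinf (a *: x + b *: y).
have [f fS] := Hahn_Banach subl; exists f => z x.
have fle s : S x s -> f x <= s.
  by move=> Ss; apply: le_trans (fS x) _; apply: ge_inf => //; have [] := Sinf x.
(* The value -oo comes first: it would put [f x - 1] into [S x], against [fle]. *)
case Hzx : (H (z, x)) => [s| |]; last 1 first.
- have := fle (f x - 1); have : S x (f x - 1) by apply: (SH z); rewrite Hzx leNye.
  by move=> Sx /(_ Sx); rewrite lerBrDr gerDl ler10.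
- by rewrite lee_fin; apply: fle; apply: (SH z); rewrite Hzx.
- by rewrite leey.
Qed.

(** Otherwise the complements of the closures are open and dense, and Baire's theorem yields a point
    outside every [A n]. *)
Lemma Baire_cover (R : realType) (X : completeNormedModType R) (A : (set X)^nat) :
  (forall x, exists n, A n x) ->
  exists n x0 (r : R), 0 < r /\ ball x0 r `<=` closure (A n).
Proof.
move=> Acover; apply: contrapT => Anot.
have /Baire dO : forall n, open (~` (closure (A n))) /\ dense (~` (closure (A n))).
  move=> n; split; first by rewrite openC; exact: closed_closure.
  apply: contrapT => /denseNE[W [[x /open_nbhs_nbhs /nbhs_ballP[r r0 xW]] WA]].
  apply: Anot; exists n, x, r; split => //.
  by move=> y /xW Wy; apply: contrapT => cy; have : set0 y by rewrite -WA; split.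
have [||x [_ Ox]] := dO setT; [by exists 0|exact: openT|].
have [n Anx] := Acover x.
by apply: (Ox n) => //; exact: subset_closure.
Qed.

Lemma cvg_half_scale_bounded (R : realType) (X : normedModType R) (u : nat -> X)
    (M : R) :
  (forall n, `|u n| <= M) -> 2^-1 ^+ n *: u n @[n --> \oo] --> 0.
Proof.
move=> uM; apply/norm_cvg0P.
apply: (@squeeze_cvgr _ _ _ _ (cst 0) (fun n => 2^-1 ^+ n * M)).
- apply: nearW => n; rewrite normr_ge0 normrZ ger0_norm//=.
  by rewrite ler_pM2l.
- exact: cvg_cst.
- rewrite -[X in _ --> X](mul0r M); apply: cvgMr_tmp; apply: cvg_expr.
  by rewrite ger0_norm// invf_lt1// ltr1n.
Qed.

(* Successive approximation writes [x] as the series [\sum_k 2^-(k+1) (p_k).2] with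
   [p_k] in [C]; the first components form a convergent series since [Z] is
   complete, and its sum with [x] is a limit of dyadic convex combinations. *)
Lemma ball_sub_projection (R : realType) (Z : completeNormedModType R) (X : normedModType R)
    (C : set (Z * X)) (M : R) (x0 : X) (r : R) :
  (forall p q, C p -> C q -> C (2^-1 *: (p + q))) -> closed C ->
  (forall p, C p -> `|p.1| <= M) ->
  ball x0 r `<=` closure (snd @` C) ->
  ball x0 (r / 2) `<=` snd @` C.
Proof.
move=> Cmid Cclosed CM Cdense x.
rewrite -ball_normE /= => xx0.
have r0 : 0 < r / 2 by exact: le_lt_trans xx0.
(* The point 2 y - x0 lies in the large ball, so some [p] in [C] has [p.2] within r / 2 of it; the
   new remainder 2 y - p.2 is then within r / 2 of [x0]. The condition sits under the quantifier so
   that [choice] applies. *)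
have step y : exists p, `|x0 - y| < r / 2 ->
    C p /\ `|x0 - (2 *: y - p.2)| < r / 2.
  have [yx0|] := ltP `|x0 - y| (r / 2); last by exists 0.
  have /Cdense : ball x0 r (2 *: y - x0).
    rewrite -ball_normE /= opprB addrA -mulr2n -scaler_nat -scalerBr.
    by rewrite normrZ ger0_norm// mulrC -ltr_pdivlMr.
  move=> /(_ _ (nbhsx_ballx _ _ r0))[_ [[p Cp <-]]]; rewrite -ball_normE /= => xp.
  by exists p => _; split => //; rewrite -normrN opprB addrAC.
have [s sP] := choice step.
pose y k := iter k (fun y => 2 *: y - (s y).2) x.
have yx0 k : `|x0 - y k| < r / 2.
  by elim: k => //= k IH; have [] := sP _ IH.
have Cs k : C (s (y k)) by have [] := sP _ (yx0 k).
pose T := series (fun k => 2^-1 ^+ k.+1 *: s (y k)).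
(* The weights in [T m] sum to 1 - 2^-m, and [b] supplies the rest. The induction replaces [b] by
   its midpoint with the next term. *)
have TC m b : C b -> C (T m + 2^-1 ^+ m *: b).
  elim: m b => [|m IH] b Cb.
    by rewrite /T /series /= big_geq// add0r expr0 scale1r.
  rewrite /T seriesSr -/(T m).
  have := IH _ (Cmid _ _ (Cs m) Cb).
  by rewrite scalerA scalerDr -exprSr addrA.
(* The remainders [y m] are bounded, so these second components converge to [x]. *)
have T2 m : (T m).2 = x - 2^-1 ^+ m *: y m.
  elim: m => [|m IH].
    by rewrite /T /series /= big_geq// expr0 scale1r subrr.
  rewrite /T seriesSr -/(T m) [y m.+1]/= [LHS]/= IH scalerBr opprB scalerA exprSr.
  by rewrite -mulrA mulVf// mulr1 addrA addrAC.
have T1E m : (T m).1 = series (fun k => 2^-1 ^+ k.+1 *: (s (y k)).1) m.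
  rewrite /T /series /=; elim: m => [|m IH]; first by rewrite !big_geq.
  by rewrite !big_nat_recr//= IH.
have T1 : cvgn (series (fun k => 2^-1 ^+ k.+1 *: (s (y k)).1)).
  apply: normed_cvg.
  apply: (@series_le_cvg _ _ (geometric (2^-1 * M) 2^-1)).
  - by move=> k; exact: normr_ge0.
  - move=> k; rewrite /= mulr_ge0// mulr_ge0//.
    by apply: le_trans (CM _ (Cs 0%N)); exact: normr_ge0.
  - move=> k; rewrite /= normrZ ger0_norm// exprS -mulrA -mulrA ler_pM2l//.
    by rewrite mulrC ler_pM2r// CM.
  - by apply: is_cvg_geometric_series; rewrite ger0_norm// invf_lt1// ltr1n.
have C0 := Cs 0%N; set b := s _ in C0.
exists (limn (series (fun k => 2^-1 ^+ k.+1 *: (s (y k)).1)), x) => //.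
apply: (@closed_cvg _ _ \oo _ (fun m => T m + 2^-1 ^+ m *: b) C Cclosed).
  by apply: nearW => m; exact: TC.
rewrite (_ : (fun m => _) = fun m =>
  (series (fun k => 2^-1 ^+ k.+1 *: (s (y k)).1) m + 2^-1 ^+ m *: b.1,
   x - 2^-1 ^+ m *: (y m - b.2))); last first.
  by apply/funext => m; rewrite -T1E scalerBr opprB addrA addrAC -T2.
set l := limn _.
have c1 : series (fun k => 2^-1 ^+ k.+1 *: (s (y k)).1) m + 2^-1 ^+ m *: b.1
    @[m --> \oo] --> l.
  rewrite -[l]addr0; apply: cvgD; first exact: T1.
  by apply: (@cvg_half_scale_bounded _ _ _ `|b.1|).
have c2 : x - 2^-1 ^+ m *: (y m - b.2) @[m --> \oo] --> x.
  rewrite -[X in _ --> X]subr0; apply: cvgB; first exact: cvg_cst.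
  apply: (@cvg_half_scale_bounded _ _ _ (r / 2 + `|x0 - b.2|)) => m.
  rewrite -(subrK x0 (y m)) -addrA (le_trans (ler_normD _ _))// lerD2r.
  by rewrite distrC ltW.
exact: cvg_pair c1 c2.
Qed.

(** Some [C n] projects onto a set containing a ball, where [f] is at most [n]; translating to 0 and
    using both v and - v bounds |f| near 0. *)
Lemma linear_minorant_continuous (R : realType) (Z X : completeNormedModType R)
    (H : Z * X -> \bar R) (f : {linear X -> R^o}) :
  econvex H -> lower_semicontinuous H ->
  (forall x, exists z, (H (z, x) < +oo)%E) ->
  (forall z x, ((f x)%:E <= H (z, x))%E) -> continuous f.
Proof.
move=> Hc Hlsc Hdom fH.
pose C (n : nat) := [set p : Z * X | `|p.1| <= n%:R /\ (H p <= n%:R%:E)%E].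
have [x|n [x0 [r [r0 Cn]]]] := @Baire_cover R X (fun n => snd @` C n).
  have [z Hz] := Hdom x.
  have [s Hs] : exists s : R, (H (z, x) <= s%:E)%E.
    by move: Hz; case: (H (z, x)) => [s| |] //; [exists s|exists 0; rewrite leNye].
  have [n sn] : exists n : nat, Num.max s `|z| <= n%:R.
    exists (Num.truncn (Num.max s `|z|)).+1; exact/ltW/truncnS_gt.
  exists n, (z, x) => //; move: sn; rewrite ge_max => /andP[sn zn].
  split; first exact: zn.
  by apply: le_trans Hs _; rewrite lee_fin.
have Cmid p q : C n p -> C n q -> C n (2^-1 *: (p + q)).
  move=> [p1 p2] [q1 q2]; split.
    rewrite /= normrZ normfV ger0_norm// ler_pdivrMl//.
    by rewrite (le_trans (ler_normD _ _))// mulr_natl mulr2n lerD.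
  have h : 1 - 2^-1 = 2^-1 :> R by lra.
  have h01 : 0 < (2^-1 : R) < 1 by apply/andP; split; lra.
  have := econvex_le Hc h01 p2 q2.
  by rewrite h -scalerDr -mulrDl; congr (_ <= _%:E)%E; lra.
have Cclosed : closed (C n).
  apply: closedI.
    apply: (@closed_comp _ _ (fun p : Z * X => `|p.1|) [set a | a <= n%:R]).
      by move=> p _; apply: cvg_norm; exact: cvg_fst.
    exact: closed_le.
  rewrite -openC; have /lower_semicontinuousP/(_ n%:R) := Hlsc.
  congr open; apply/seteqP; split => p /=; first by move/lt_geF => ->.
  by move/negP; rewrite -ltNge.
have sub := ball_sub_projection Cmid Cclosed (fun p Cp => Cp.1) Cn.
have fub x : ball x0 (r / 2) x -> f x <= n%:R.
  by move=> /sub[[z y] [/= _ Hzy] <-]; rewrite -lee_fin; apply: le_trans (fH z y) _.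
apply: bounded_linear_continuous; apply/ex_bound; exists (n%:R - f x0).
apply/nbhs_norm0P; exists (r / 2) => /=; first by rewrite divr_gt0.
have fv v : `|v| < r / 2 -> f v <= n%:R - f x0.
  move=> vr; rewrite lerBrDl -linearD fub//.
  by rewrite -ball_normE /= opprD addrA subrr sub0r normrN.
move=> v /= vr; rewrite ler_norml fv// andbT lerNl.
by rewrite -linearN fv// normrN.
Qed.

(** Serves the lower semicontinuity of a sum: a finite slack is shared equally, and an infinite
    summand absorbs what the other leaves. *)
Lemma lte_addE_split (R : realType) (x y : \bar R) (a : R) :
  (-oo < x)%E -> (-oo < y)%E -> (a%:E < x + y)%E ->
  exists b c : R, [/\ (b%:E < x)%E, (c%:E < y)%E & a <= b + c].
Proof.
case: x y => [x| |] [y| |] // _ _.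
- rewrite -EFinD lte_fin => axy.
  exists (x - (x + y - a) / 2), (y - (x + y - a) / 2).
  by split; rewrite ?lte_fin; lra.
- by exists (x - 1), (a - (x - 1)); split; rewrite ?ltry ?lte_fin//; lra.
- by exists (a - (y - 1)), (y - 1); split; rewrite ?ltry ?lte_fin//; lra.
- by exists a, 0; split; rewrite ?ltry// addr0.
Qed.

(** The sum F + G is H (z, x) = F (z + x) + G z at x = 0, and the domain hypothesis keeps the
    marginal of [H] below +oo. Its linear minorant at x - y, tested with z = y, gives the
    conclusion. *)
Theorem Attouch_Brezis (R : realType) (V : completeNormedModType R) (F G : V -> \bar R) :
  econvex F -> econvex G -> lower_semicontinuous F -> lower_semicontinuous G ->
  (forall x, (-oo < F x)%E) -> (forall x, (-oo < G x)%E) ->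
  (forall x, exists z, (F (z + x)%R < +oo)%E /\ (G z < +oo)%E) ->
  (forall x, (0 <= F x + G x)%E) ->
  exists2 f : {linear V -> R^o}, continuous f &
    forall x y, ((f (x - y))%:E <= F x + G y)%E.
Proof.
move=> Fc Gc Fl Gl FN GN dom FG.
pose H (p : V * V) := (F (p.1 + p.2)%R + G p.1)%E.
have Hc : econvex H.
  move=> p q t t01; have := t01 => /andP[t0 t1].
  have t1' : 0 < 1 - t by rewrite subr_gt0.
  rewrite /H /= addrACA -!scalerDr.
  apply: le_trans (leeD (Fc _ _ t t01) (Gc _ _ t t01)) _.
  by rewrite addeACA !muleDr// ltninfty_adde_def ?inE.
have Hl : lower_semicontinuous H.
  move=> p a /(lte_addE_split (FN _) (GN _))[b [c [bF cG abc]]].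
  have [A pA AF] := Fl _ _ bF; have [B pB BG] := Gl _ _ cG.
  exists [set q | A (q.1 + q.2) /\ B q.1].
    apply: filterI; last exact: cvg_fst pB.
    have : q.1 + q.2 @[q --> p] --> p.1 + p.2.
      by apply: cvgD; [exact: cvg_fst|exact: cvg_snd].
    exact.
  move=> q [/AF bFq /BG cGq]; rewrite /H.
  by apply: le_lt_trans (lteD bFq cGq); rewrite -EFinD lee_fin.
have Hdom x : exists z, (H (z, x) < +oo)%E.
  by have [z [Fz Gz]] := dom x; exists z; rewrite /H/= lte_add_pinfty.
have H0 z : (0 <= H (z, 0%R))%E by rewrite /H/= addr0.
have [f fH] := linear_minorant_of_marginal Hc Hdom H0.
exists f; first exact: linear_minorant_continuous Hc Hl Hdom fH.
by move=> x y; have := fH y (x - y); rewrite /H/= [(y + _)%R]addrC subrK.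
Qed.

(** * The dual as a Banach space *)

Section DualSpace.
Context {R : realType} {E : normedModType R}.

Definition in_dualb : pred (E -> R) := fun phi => `[< in_dual phi >].

Lemma in_dual_submod : subsemimod_closed in_dualb.
Proof.
split; first split.
- apply/asboolP; split=> [a x y|]; first by rewrite mulr0 addr0.
  exact: cst_continuous.
- move=> /= phi psi /asboolP[phiL phiC] /asboolP[psiL psiC]; apply/asboolP; split.
    by move=> a x y /=; rewrite !fctE phiL psiL mulrDr addrACA.
  by move=> x; apply: continuousD; [exact: phiC|exact: psiC].
- move=> b phi /asboolP[phiL phiC]; apply/asboolP; split.
    move=> a x y; rewrite !fctE phiL /GRing.scale /=; ring.
  by move=> x; apply: continuousM; [exact: cst_continuous|exact: phiC].
Qed.

HB.instance Definition _ :=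
  GRing.isSubmodClosed.Build R (E -> R) in_dualb in_dual_submod.

(** Bundling makes general results on complete normed spaces applicable, while the coercion keeps
    statements on bare functions usable. *)
Record dual := Dual { dual_fun :> E -> R; _ : in_dualb dual_fun }.
HB.instance Definition _ := [isSub for dual_fun].
HB.instance Definition _ := [Choice of dual by <:].
HB.instance Definition _ := [SubChoice_isSubLmodule of dual by <:].

Lemma dualP (phi : dual) : in_dual phi.
Proof. by apply/asboolP; case: phi. Qed.
#[local] Hint Resolve dualP : core.

Lemma in_dual0 (phi : E -> R) : in_dual phi -> phi 0 = 0.
Proof. by move=> [/(_ (-1) 0 0) + _]; rewrite scaler0 addr0 mulN1r addNr. Qed.

Lemma dual_bounded (phi : E -> R) : in_dual phi ->
  exists2 M : R, 0 < M & forall x, `|phi x| <= M * `|x|.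
Proof.
move=> [phiL phiC].
pose f : {linear E -> R^o} := HB.pack phi (GRing.isLinear.Build _ _ _ _ phi phiL).
have : bounded_near f (nbhs 0).
  by apply: continuous_linear_bounded; exact: phiC.
by move=> /linear_boundedP/pinfty_ex_gt0[M M0 fM]; exists M.
Qed.

Lemma bounded_in_dual (phi : E -> R) :
  (forall (a : R) (x y : E), phi (a *: x + y) = a * phi x + phi y) ->
  (exists M : R, forall x, `|phi x| <= M * `|x|) -> in_dual phi.
Proof.
move=> phiL [M phiM]; split => //.
pose f : {linear E -> R^o} := HB.pack phi (GRing.isLinear.Build _ _ _ _ phi phiL).
apply: (@bounded_linear_continuous _ _ _ f).
apply/bounded_funP => r; exists (`|M| * r) => x xr.
apply: le_trans (phiM x) _; apply: (@le_trans _ _ (`|M| * `|x|)).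
  by rewrite ler_wpM2r// ler_norm.
by rewrite ler_wpM2l.
Qed.

(** [sup] is a default value unless the set is nonempty and bounded above. *)
Lemma dnorm_has_sup (phi : E -> R) : in_dual phi ->
  has_sup [set `|phi x| | x in [set x : E | `|x| <= 1]].
Proof.
move=> /dual_bounded[M M0 phiM]; split.
  by exists `|phi 0|, 0 => //=; rewrite normr0.
exists M => _ [x /= x1 <-]; apply: le_trans (phiM x) _.
by rewrite ler_piMr// ltW.
Qed.

Lemma dnorm_nneg (phi : E -> R) : in_dual phi -> 0 <= dnorm phi.
Proof.
move=> phid; apply: le_trans (normr_ge0 (phi 0)) _.
apply: ub_le_sup; first by have [] := dnorm_has_sup phid.
by exists 0 => //=; rewrite normr0.
Qed.

Lemma dnorm_ub (phi : E -> R) x : in_dual phi -> `|phi x| <= dnorm phi * `|x|.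
Proof.
move=> phid; have [->|x0] := eqVneq x 0.
  by rewrite (in_dual0 phid) !normr0 mulr0.
have xgt0 : 0 < `|x| by rewrite normr_gt0.
rewrite -ler_pdivrMr//.
have -> : `|phi x| / `|x| = `|phi (`|x|^-1 *: x)|.
  case: (phid) => /(_ `|x|^-1 x 0) + _; rewrite (in_dual0 phid) !addr0 => ->.
  by rewrite normrM normfV normr_id mulrC.
apply: ub_le_sup; first by have [] := dnorm_has_sup phid.
by exists (`|x|^-1 *: x) => //=; rewrite normfZV.
Qed.

Lemma dnorm_le (phi : E -> R) (M : R) : 0 <= M ->
  (forall x, `|phi x| <= M * `|x|) -> dnorm phi <= M.
Proof.
move=> M0 phiM; apply: ge_sup; first by exists `|phi 0|, 0 => //=; rewrite normr0.
by move=> _ [x /= x1 <-]; apply: le_trans (phiM x) _; rewrite ler_piMr.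
Qed.

Lemma ler_dnormD (phi psi : dual) : dnorm (phi + psi : dual) <= dnorm phi + dnorm psi.
Proof.
apply: dnorm_le => [|x]; first by rewrite addr_ge0// dnorm_nneg.
apply: le_trans (ler_normD (phi x) (psi x)) _.
by rewrite mulrDl; apply: lerD; exact: dnorm_ub.
Qed.

Lemma dnormZ (a : R) (phi : dual) : dnorm (a *: phi : dual) = `|a| * dnorm phi.
Proof.
have le_dnormZ (b : R) (psi : dual) : dnorm (b *: psi : dual) <= `|b| * dnorm psi.
  apply: dnorm_le => [|x]; first by rewrite mulr_ge0// dnorm_nneg.
  rewrite [`|_|]normrM -mulrA ler_wpM2l//; exact: dnorm_ub.
apply/eqP; rewrite eq_le le_dnormZ andTb.
have [->|a0] := eqVneq a 0.
  by rewrite normr0 mul0r dnorm_nneg.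
(* The converse is the same inequality for the inverse scalar. *)
have := le_dnormZ a^-1 (a *: phi); rewrite scalerA mulVf// scale1r.
by rewrite normfV ler_pdivlMl// normr_gt0.
Qed.

Lemma dnorm_eq0 (phi : dual) : dnorm phi = 0 -> phi = 0.
Proof.
move=> phi0; apply/val_inj/funext => x /=; apply/eqP; rewrite -normr_le0.
by have := dnorm_ub x (dualP phi); rewrite phi0 mul0r.
Qed.

HB.instance Definition _ :=
  Lmodule_isNormed.Build R dual ler_dnormD dnormZ dnorm_eq0.

Lemma norm_dualE (phi : dual) : `|phi| = dnorm phi. Proof. by []. Qed.

(** A Cauchy filter converges pointwise to a linear [l]. The Cauchy bounds pass to the pointwise
    limit, giving both the boundedness of [l] and convergence in norm. *)
Lemma dual_complete (F : set_system dual) : ProperFilter F -> cauchy F -> cvg F.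
Proof.
move=> FF /cauchyP Fc.
have Fball (e : R) : 0 < e -> exists phi : dual, \forall psi \near F, `|phi - psi| < e.
  by move=> e0; have [phi] := Fc e e0; rewrite -ball_normE; exists phi.
have evcvg x : cvg ((fun phi : dual => phi x) @ F).
  apply: cauchy_cvg; apply/cauchyP => e e0.
  have x1 : 0 < `|x| + 1 by rewrite ltr_wpDl.
  have [phi Fphi] := Fball _ (divr_gt0 e0 x1).
  exists (phi x); rewrite -ball_normE.
  apply: filterS Fphi => psi /= pp.
  have := dnorm_ub x (dualP (phi - psi)) => /le_lt_trans; apply.
  apply: le_lt_trans (_ : _ <= dnorm (phi - psi : dual) * (`|x| + 1)) _.
    by rewrite ler_wpM2l ?dnorm_nneg ?lerDl.
  by rewrite -ltr_pdivlMr.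
pose l x : R := lim ((fun phi : dual => phi x) @ F).
have lL a x y : l (a *: x + y) = a * l x + l y.
  apply/cvg_lim => //.
  rewrite [X in X @ F](_ : _ = fun phi : dual => a * phi x + phi y); last first.
    by apply/funext => phi; case: (dualP phi) => ->.
  by apply: cvgD; [apply: cvgMl_tmp; exact: evcvg|exact: evcvg].
have near_l (e : R) : 0 < e ->
    \forall phi \near F, forall x, `|l x - (phi : dual) x| <= e * `|x|.
  move=> e0; have [chi Fchi] := Fball _ (divr_gt0 e0 (ltr0Sn R 1)).
  apply: filterS (Fchi) => phi chiphi x.
  have cl : `|psi x - phi x| @[psi --> F] --> `|l x - phi x|.
    by apply: cvg_norm; apply: cvgB; [exact: evcvg|exact: cvg_cst].
  apply: (closed_cvg (fun r => r <= e * `|x|) _ _ _ cl); first exact: closed_le.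
  apply: filterS Fchi => psi chipsi.
  apply: le_trans (dnorm_ub x (dualP (psi - phi))) _.
  rewrite ler_wpM2r// -norm_dualE -(subrK chi psi) -addrA.
  rewrite (splitr e) (le_trans (ler_normD _ _))// lerD// ltW//.
  by rewrite distrC.
have ld : in_dualb l.
  apply/asboolP; apply: bounded_in_dual => //.
  have [phi phil] := filter_ex (near_l 1 ltr01).
  exists (dnorm phi + 1) => x; rewrite -(subrK (phi x) (l x)) addrC mulrDl.
  by rewrite (le_trans (ler_normD _ _))// lerD// dnorm_ub.
apply/cvg_ex; exists (Dual ld); apply/cvgrPdist_le => e e0.
apply: filterS (near_l e e0) => phi lphi.
by rewrite norm_dualE; apply: dnorm_le; [exact: ltW|].
Qed.

HB.instance Definition _ := Uniform_isComplete.Build dual dual_complete.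
End DualSpace.
Arguments dual {R} E.

(** * Completeness of a product of Banach spaces *)

Section ProductComplete.
Context {R : realType} (U V : completeNormedModType R).

HB.instance Definition _ := Pointed.on (U * V)%type.

Lemma prod_complete (F : set_system (U * V)) : ProperFilter F -> cauchy F -> cvg F.
Proof.
move=> FF /cauchyP Fc.
have c1 : cvg (fst @ F).
  apply: cauchy_cvg; apply/cauchyP => e e0; have [x Fx] := Fc e e0.
  exists x.1; suff : F (fst @^-1` ball x.1 e) by [].
  by apply: filterS Fx => y [].
have c2 : cvg (snd @ F).
  apply: cauchy_cvg; apply/cauchyP => e e0; have [x Fx] := Fc e e0.
  exists x.2; suff : F (snd @^-1` ball x.2 e) by [].
  by apply: filterS Fx => y [].
apply/cvg_ex; exists (lim (fst @ F), lim (snd @ F)).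
move=> A /(cvg_pair c1 c2) FA.
by apply: (@filterS _ F _ _ A _ FA) => -[].
Qed.

HB.instance Definition _ := Uniform_isComplete.Build (U * V)%type prod_complete.
End ProductComplete.

(** * BC-functions *)

Section BCFunctions.
Context {R : realType} {E : normedModType R}.
Implicit Types (k : E -> (E -> R) -> \bar R) (phi psi : E -> R).

(** Closure properties of [in_dual] can then be read off the module structure of [dual E]. *)
Lemma in_dual_repr phi : in_dual phi -> exists d : dual E, phi = d.
Proof. by move=> /asboolP phid; exists (Dual phid). Qed.

Lemma in_dual_linear s phi psi : in_dual phi -> in_dual psi ->
  in_dual (fun u => s * phi u + psi u).
Proof.
move=> /in_dual_repr[d ->] /in_dual_repr[e ->]; exact: dualP (s *: d + e).
Qed.

Lemma in_dualB phi psi : in_dual phi -> in_dual psi -> in_dual (fun u => phi u - psi u).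
Proof.
move=> /in_dual_repr[d ->] /in_dual_repr[e ->]; exact: dualP (d - e).
Qed.

Lemma in_dualN phi : in_dual phi -> in_dual (fun u => - phi u).
Proof. by move=> /in_dual_repr[d ->]; exact: dualP (- d). Qed.

Lemma BC_ge k x phi : BC k -> in_dual phi -> ((phi x)%:E <= k x phi)%E.
Proof. by move=> [_ [_ +]] phid => /(_ x phi phid)[]. Qed.

Lemma BC_fat k x phi : BC k -> in_dual phi -> (k x phi <= fat k x phi)%E.
Proof. by move=> [_ [_ +]] phid => /(_ x phi phid)[]. Qed.

Lemma BC_gtNy k x phi : BC k -> in_dual phi -> (-oo < k x phi)%E.
Proof. by move=> kBC phid; apply: lt_le_trans (BC_ge x kBC phid); rewrite ltNyr. Qed.

(* Fixing one term of the sum bounds the conjugate of the other function. *)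
Lemma Pq_of_conjugate_bound k1 k2 y psi1 psi2 : BC k1 -> BC k2 ->
  in_dual psi1 -> in_dual psi2 -> psi1 y + psi2 y = 0 ->
  (forall x phi z chi, in_dual phi -> in_dual chi ->
    ((psi1 x + phi y + (psi2 z + chi y))%:E <= k1 x phi + k2 z chi)%E) ->
  Pq k1 y psi1.
Proof.
move=> k1BC k2BC d1 d2 psi12 kk; split => //.
apply/eqP; rewrite eq_le BC_ge// andbT.
apply: le_trans (BC_fat y k1BC d1) _; apply: ge_ereal_sup => _ [x [phi [phid ->]]].
have := BC_gtNy x k1BC phid; case kx : (k1 x phi) => [b| |] // _; last by rewrite leNye.
rewrite -EFinB lee_fin.
(* As psi1 y = - psi2 y, it remains to bound [psi2 y], which is at most the conjugate of [k2]; [kk]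
   bounds each of its terms. *)
suff : ((psi2 y)%:E <= (b - (psi1 x + phi y))%:E)%E by rewrite lee_fin; lra.
apply: le_trans (BC_ge y k2BC d2) _; apply: le_trans (BC_fat y k2BC d2) _.
apply: ge_ereal_sup => _ [z [chi [chid ->]]].
have := kk x phi z chi phid chid; rewrite kx.
have := BC_gtNy z k2BC chid; case: (k2 z chi) => [c| |] // _; last by rewrite leNye.
by rewrite -EFinD -EFinB !lee_fin; lra.
Qed.

(* For [s * s = 1] the affine term is [q (s y + a, s psi + al) - q (y, psi)], so this
   preserves the order relation to [q] and carries [P_q] to [P_q]. *)
Definition affine_conj (s : R) (a : E) (al : E -> R) k y psi : \bar R :=
  (k (s *: y + a)%R (fun u => s * psi u + al u)%R
   - (s * psi a + s * al y + al a)%R%:E)%E.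

Section AffineConj.
Variables (s : R) (a : E) (al : E -> R).
Hypotheses (ss : s * s = 1) (ald : in_dual al).

Let in_dualE phi : in_dual phi ->
  forall (c : R) x y, phi (c *: x + y) = c * phi x + phi y.
Proof. by case. Qed.

Lemma Pq_affine_conj k y psi : in_dual psi -> Pq (affine_conj s a al k) y psi ->
  Pq k (s *: y + a) (fun u => s * psi u + al u).
Proof.
move=> psid [_]; rewrite /affine_conj => kq; split; first exact: in_dual_linear.
rewrite !(in_dualE psid, in_dualE ald) //.
move: kq; case: (k _ _) => // r; rewrite -EFinB => -[rE]; congr (_%:E).
have -> : r = psi y + (s * psi a + s * al y + al a) by rewrite -rE; lra.
by rewrite mulrDr mulrA ss; ring.
Qed.

Lemma BC_affine_conj k : BC k -> BC (affine_conj s a al k).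
Proof.
move=> kBC; have [[[x0 [phi0 [phi0d kx0]]] kN] [kc kq]] := kBC.
(* As s * s = 1, the map x -> s (x - a) inverts the substitution. *)
have sK (x : E) : s *: (s *: (x - a)) + a = x by rewrite scalerA ss scale1r subrK.
have sKd phi : (fun u => s * (s * (phi u - al u)) + al u) = phi.
  by apply/funext => u; rewrite mulrA ss mul1r subrK.
have subd phi : in_dual phi -> in_dual (fun u => s * (phi u - al u)).
  move: ald => /in_dual_repr[d ->] /in_dual_repr[e ->]; exact: dualP (s *: (e - d)).
have linE phi x y : in_dual phi -> phi (s *: (x - y)) = s * (phi x - phi y).
  move=> phid; have := in_dualE phid s (x - y) 0.
  have := in_dualE phid (-1) y x.
  by rewrite (in_dual0 phid) !addr0 scaleN1r addrC => -> ->; ring.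
split; last split.
- split.
    exists (s *: (x0 - a)), (fun u => s * (phi0 u - al u)); split; first exact: subd.
    rewrite /affine_conj sK sKd; move: kx0; case: (k x0 phi0) => // r _.
    by rewrite -EFinB ltry.
  move=> x phi phid; rewrite /affine_conj.
  have := kN (s *: x + a) _ (in_dual_linear s phid ald).
  by case: (k _ _) => // r _; rewrite -EFinB ltNyr.
- move=> x y phi psi t phid psid t01; rewrite /affine_conj.
  have kxN := kN (s *: x + a) _ (in_dual_linear s phid ald).
  have kyN := kN (s *: y + a) _ (in_dual_linear s psid ald).
  have := kc (s *: x + a) (s *: y + a) _ _ t (in_dual_linear s phid ald)
    (in_dual_linear s psid ald) t01.
  rewrite (_ : t *: (s *: x + a) + _ = s *: (t *: x + (1 - t) *: y) + a); last first.
    rewrite !scalerDr !scalerA addrACA -[t *: a + _]scalerDl.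
    by rewrite [t + _]addrC subrK scale1r (mulrC t) (mulrC (1 - t)).
  rewrite (_ : (fun u => t * _ + _) =
    fun u => s * (t * phi u + (1 - t) * psi u) + al u); last first.
    by apply/funext => u; ring.
  move: t01 => /andP[t0 t1]; have t1' : 0 < 1 - t by rewrite subr_gt0.
  rewrite (in_dualE ald).
  have -> : al ((1 - t) *: y) = (1 - t) * al y.
    by have := in_dualE ald (1 - t) y 0; rewrite (in_dual0 ald) !addr0.
  move: (k (s *: (_ + _) + a) _) kxN kyN => Z.
  case: (k (s *: x + a) _) => [X| |] // _; case: (k (s *: y + a) _) => [Y| |] // _.
  + case: Z => [Z| |] // kXY; last by rewrite leNye.
    by move: kXY; rewrite -!EFinB -!EFinM -!EFinD !lee_fin; lra.
  + move=> _; rewrite -EFinB -EFinM [(+oo - _)%E]addye// gt0_muley ?lte_fin//.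
    by rewrite addey// leey.
  + move=> _; rewrite -EFinB -EFinM [(+oo - _)%E]addye// gt0_muley ?lte_fin//.
    by rewrite addye// leey.
  + by move=> _; rewrite ![(+oo - _)%E]addye// !gt0_muley ?lte_fin// addye// leey.
- move=> x phi phid; rewrite /affine_conj.
  have lphi := in_dual_linear s phid ald.
  have [kge kle] := kq (s *: x + a) _ lphi; split.
    move: kge; case: (k _ _) => [r| |] //; last by move=> _; rewrite addye// leey.
    rewrite -EFinB !lee_fin.
    rewrite !(in_dualE phid, in_dualE ald) mulrDr mulrA ss; lra.
  (* Each term of the conjugate of [k] at the image point, less the affine term, is a term of the
     conjugate of the transformed function. *)
  rewrite leeBlDr//; apply: le_trans kle _; apply: ge_ereal_sup => _ [y [psi [psid ->]]].
  rewrite -leeBlDr//; apply: ereal_sup_ubound.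
  exists (s *: (y - a)), (fun u => s * (psi u - al u)); split; first exact: subd.
  rewrite /affine_conj sK sKd.
  have := kN y psi psid; case: (k y psi) => [r| |] // _.
  rewrite -!EFinB; congr (_%:E).
  rewrite !linE// (in_dualE psid) !mulrBr !mulrA ss; ring.
Qed.

(** Since |s| = 1, the substitution is an isometry for [pdist], and the subtracted term [c] is
    Lipschitz with constant [M]. The slack [d] absorbs its variation. *)
Lemma lsc_affine_conj k : BC k -> lsc k -> lsc (affine_conj s a al k).
Proof.
move=> kBC klsc x phi phid b; rewrite /affine_conj => bk.
have lphi := in_dual_linear s phid ald.
pose c (y : E) psi := s * psi a + s * al y + al a.
have [d d0 bdk] : exists2 d : R, 0 < d &
    ((b + c x phi + d)%:E < k (s *: x + a)%R (fun u => s * phi u + al u)%R)%E.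
  move: bk (BC_gtNy (s *: x + a) kBC lphi); rewrite -/(c x phi).
  case: (k _ _) => [r| |] //; last by exists 1; rewrite ?ltry.
  rewrite -EFinB lte_fin => bk _; exists ((r - (b + c x phi)) / 2); first by lra.
  by rewrite lte_fin; lra.
have [e e0 ek] := klsc _ _ lphi _ bdk.
pose M := `|a| + dnorm al + 1.
have M0 : 0 < M by have := normr_ge0 a; have := dnorm_nneg ald; rewrite /M; lra.
have s1 : `|s| = 1.
  have : `|s| * `|s| = 1 by rewrite -normrM ss normr1.
  have := normr_ge0 s; nra.
exists (Num.min e (d / M)); first by rewrite lt_min e0 divr_gt0.
move=> y psi psid; rewrite lt_min => /andP[pe pd].
have lpsi := in_dual_linear s psid ald.
have pE : pdist (s *: x + a) (fun u => s * phi u + al u)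
    (s *: y + a) (fun u => s * psi u + al u) = pdist x phi y psi.
  rewrite /pdist opprD addrACA subrr addr0 -scalerBr normrZ s1 mul1r.
  congr (_ + _); rewrite /dnorm; congr (sup _); apply: eq_imagel => u _.
  by rewrite opprD addrACA subrr addr0 -mulrBr normrM s1 mul1r.
have cc : `|c y psi - c x phi| <= d.
  have -> : c y psi - c x phi = s * (psi a - phi a) + s * (al y - al x).
    by rewrite /c; ring.
  apply: le_trans (ler_normD _ _) _; rewrite !normrM s1 !mul1r.
  have nd := dnorm_ub a (in_dualB phid psid).
  have na := dnorm_ub (x - y) ald.
  have alB : al (x - y) = al x - al y.
    by have := in_dualE ald (-1) y x; rewrite scaleN1r mulN1r addrC => ->; rewrite addrC.
  rewrite alB distrC in na; rewrite distrC.
  have n0 := normr_ge0 (x - y); have p0 := dnorm_nneg (in_dualB phid psid).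
  have a0 := normr_ge0 a; have al0 := dnorm_nneg ald.
  have : pdist x phi y psi * M <= d by rewrite -ler_pdivlMr// ltW.
  rewrite /pdist /M; move: nd na n0 p0 a0 al0.
  move: (dnorm _) (`|x - y|) (dnorm al) `|a| => P N D A /=; nra.
have := ek (s *: y + a) _ lpsi; rewrite pE => /(_ pe).
rewrite -/(c y psi); case: (k _ _) => [r| |] //; rewrite -?EFinB ?ltry// !lte_fin.
by move: cc; rewrite ler_norml => /andP[]; lra.
Qed.

End AffineConj.
Lemma econvex_on_dual k : convex_fun k -> econvex (fun p : E * dual E => k p.1 p.2).
Proof.
move=> kc [x phi] [y psi] t t01 /=.
exact: (kc x y phi psi t (dualP phi) (dualP psi) t01).
Qed.

Lemma lower_semicontinuous_on_dual k : lsc k ->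
  lower_semicontinuous (fun p : E * dual E => k p.1 p.2).
Proof.
move=> klsc p b bk; have [e e0 ek] := klsc _ _ (dualP p.2) _ bk.
(* The product norm is a maximum and [pdist] a sum, hence the radius e / 2. *)
exists (ball p (e / 2)); first by apply: nbhsx_ballx; rewrite divr_gt0.
move=> q; rewrite -ball_normE /= prod_normE gt_max => /andP[pq1 pq2].
by apply: ek; [exact: dualP|rewrite (splitr e) ltrD].
Qed.

End BCFunctions.

(** * Points of P_q f whose reflections lie in P_q g *)

Section Meeting.
Context {R : realType} {E : completeNormedModType R}.

(* On the pairs [(0, phi)] a continuous functional is an element of the bidual. *)
Lemma reflexive_representation (zeta : {linear (E * dual E)%type -> R^o}) :
  reflexive_space E -> continuous zeta ->
  exists2 a : E -> R, in_dual a &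
    exists x0 : E, forall x (phi : dual E), zeta (x, phi) = a x + phi x0.
Proof.
move=> Erefl zetaC.
have [M M0 zetaM] : exists2 M : R, 0 < M & forall p, `|zeta p| <= M * `|p|.
  have : bounded_near zeta (nbhs 0) by apply/linear_bounded_continuous.
  by move=> /linear_boundedP/pinfty_ex_gt0[M M0 zM]; exists M.
(* [reflexive_space] takes functionals defined on all functions; outside the dual, [insubd]
   substitutes 0. *)
pose Phi (phi : E -> R) := zeta (0, insubd (0 : dual E) phi) : R.
have PhiE (phi : dual E) : Phi phi = zeta (0, phi) by rewrite /Phi valKd.
have [b phi psi|phi phid e e0|x0 x0E] := Erefl Phi.
- move=> /in_dual_repr[d ->] /in_dual_repr[e ->].
  rewrite (PhiE (b *: d + e)) !PhiE.
  have -> : (0, b *: d + e) = b *: (0, d) + (0, e) :> (E * dual E)%type.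
    by congr pair; rewrite /= scaler0 addr0.
  by rewrite linearP.
- have [d ->] := in_dual_repr phid.
  exists (e / M); first by rewrite divr_gt0.
  move=> _ /in_dual_repr[c ->] cd.
  rewrite !PhiE -linearB; apply: le_lt_trans (zetaM _) _.
  rewrite mulrC -ltr_pdivlMr// prod_normE /= subrr normr0 gt_max divr_gt0//.
exists (fun x => zeta (x, 0)).
  apply: bounded_in_dual => [b x y|].
    have -> : (b *: x + y, 0) = b *: (x, 0) + (y, 0) :> (E * dual E)%type.
      by congr pair; rewrite /= scaler0 addr0.
    by rewrite linearP.
  exists M => x; apply: le_trans (zetaM _) _.
  by rewrite prod_normE /= normr0 max_l.
exists x0 => x phi; rewrite -x0E ?PhiE; last exact: dualP.
rewrite -[RHS](linearD zeta); congr (zeta _).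
by congr pair; rewrite /= ?addr0 ?add0r.
Qed.

Lemma Pq_meet (f g : E -> (E -> R) -> \bar R) (w : E -> R) :
  reflexive_space E -> lsc f -> lsc g -> BC f -> BC g ->
  in_dual w -> (forall x : E, f x w \is a fin_num) ->
  (forall phi : E -> R, in_dual phi -> exists x : E, g x phi \is a fin_num) ->
  exists y psi, Pq f y psi /\ Pq g y (fun u => - psi u).
Proof.
move=> Erefl flsc glsc fBC gBC wd fw gdom.
pose F (p : E * dual E) := f p.1 p.2.
pose G (p : E * dual E) := g p.1 (- p.2 : dual E).
have [||||p|p|p|p|zeta zetaC zetaFG] := @Attouch_Brezis R (E * dual E)%type F G.
- exact: econvex_on_dual fBC.2.1.
- move=> p q t t01.
  have := gBC.2.1 p.1 q.1 _ _ t (dualP (- p.2)) (dualP (- q.2)) t01.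
  rewrite /G; congr (g _ _ <= _)%E; apply/funext => u /=.
  by rewrite !mulrN -opprD.
- exact: lower_semicontinuous_on_dual.
- move=> p b /(lower_semicontinuous_on_dual glsc (x := (p.1, - p.2)))[A Ap Ab].
  exists [set q | A (q.1, - q.2)]; last by move=> q /Ab.
  have : (q.1, - q.2) @[q --> p] --> (p.1, - p.2).
    have c1 : q.1 @[q --> p] --> p.1 by exact: cvg_fst.
    have c2 : - q.2 @[q --> p] --> - p.2 by apply: cvgN; exact: cvg_snd.
    exact: cvg_pair c1 c2.
  exact.
- exact: BC_gtNy fBC (dualP _).
- exact: BC_gtNy gBC (dualP _).
- have [d wE] := in_dual_repr wd; rewrite wE in fw.
  have [z gz] := gdom (p.2 - d : dual E) (dualP _).
  (* [F] is evaluated at (z + p.1, d), where [fw] applies, and [G] evaluates [g] at (z, p.2 - d),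
     where [z] was chosen. *)
  exists (z, d - p.2); rewrite /F /G /= subrK opprB; split.
    by have := fw (z + p.1); rewrite fin_numElt => /andP[].
  by move: gz; rewrite fin_numElt => /andP[].
- apply: le_trans (leeD (BC_ge p.1 fBC (dualP p.2)) (BC_ge p.1 gBC (dualP (- p.2)))).
  by rewrite -EFinD lee_fin subrr.
have [a ad [x0 zetaE]] := reflexive_representation Erefl zetaC.
(* This is the form that [Pq_of_conjugate_bound] expects, for the functionals a and - a at [x0]. *)
have key x phi z chi : in_dual phi -> in_dual chi ->
    ((a x + phi x0 + (- a z + chi x0))%:E <= f x phi + g z chi)%E.
  move=> /in_dual_repr[d ->] /in_dual_repr[e ->].
  have := zetaFG (x, d) (z, - e); rewrite /F /G /= opprK.
  have -> : (x, d) - (z, - e) = (x - z, d + e) :> (E * dual E)%type.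
    by congr pair; rewrite /= opprK.
  rewrite zetaE; congr (_%:E <= _)%E.
  have -> : a (x - z) = a x - a z.
    by case: ad => /(_ (-1) z x) + _; rewrite scaleN1r mulN1r addrC => ->; rewrite addrC.
  by rewrite (_ : (d + e) x0 = d x0 + e x0)// addrACA.
have aNd := in_dualN ad.
exists x0, a; split.
  by apply: (Pq_of_conjugate_bound fBC gBC ad aNd); rewrite ?subrr.
apply: (Pq_of_conjugate_bound gBC fBC aNd ad); first by rewrite addNr.
by move=> x phi z chi phid chid; rewrite addrC addeC; exact: key.
Qed.

(** [Pq_meet] for [f] and the transformed [g] gives (y, - psi) in P_q of the latter, which the
    substitution sends to (s y + a, al - s psi). *)
Lemma Pq_difference (f g : E -> (E -> R) -> \bar R) (w : E -> R) (s : R) (a : E)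
    (al : E -> R) :
  reflexive_space E -> lsc f -> lsc g -> BC f -> BC g ->
  in_dual w -> (forall x : E, f x w \is a fin_num) ->
  (forall phi : E -> R, in_dual phi -> exists x : E, g x phi \is a fin_num) ->
  s * s = 1 -> in_dual al ->
  exists y psi, Pq f y psi /\ Pq g (s *: y + a) (fun u => al u - s * psi u).
Proof.
move=> Erefl flsc glsc fBC gBC wd fw gdom ss ald.
have [phi phid|y [psi [fy gy]]] := Pq_meet Erefl flsc
  (lsc_affine_conj ss ald gBC glsc) fBC (BC_affine_conj a ss ald gBC) wd fw.
  have [z gz] := gdom _ (in_dual_linear s phid ald).
  exists (s *: (z - a)); rewrite /affine_conj scalerA ss scale1r subrK.
  by rewrite fin_numB gz.
exists y, psi; split => //.
have := Pq_affine_conj ss ald (in_dualN fy.1) gy.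
by congr (Pq _ _ _); apply/funext => u; rewrite mulrN addrC.
Qed.

End Meeting.

(** * Decompositions of pairs, vectors and functionals *)

Unset Implicit Arguments.
Set Strict Implicit.
Set Printing Implicit Defensive.
Theorem theorem7p4 (R : realType) (E : completeNormedModType R)
  (f g : E -> (E -> R) -> \bar R) (w : E -> R) :
  (exists x : E, x != 0) -> reflexive_space E ->
  lsc f -> lsc g -> BC f -> BC g ->
  in_dual w -> (forall x : E, f x w \is a fin_num) ->
  (forall phi : E -> R, in_dual phi -> exists x : E, g x phi \is a fin_num) ->
  [/\ (forall (x : E) (phi : E -> R), in_dual phi ->
         exists (y : E) (psi : E -> R) (z : E) (chi : E -> R),
           [/\ Pq f y psi, Pq g z chi, y - z = x & forall u, psi u + chi u = phi u]),
      (forall (x : E) (phi : E -> R), in_dual phi ->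
         exists (y : E) (psi : E -> R) (z : E) (chi : E -> R),
           [/\ Pq f y psi, Pq g z chi, y + z = x & forall u, psi u - chi u = phi u]),
      (forall x : E, exists (y z : E) (psi : E -> R),
           [/\ Pq f y psi, Pq g z psi & y + z = x]) &
      (forall phi : E -> R, in_dual phi ->
         exists (y : E) (psi chi : E -> R),
           [/\ Pq f y psi, Pq g y chi & forall u, psi u + chi u = phi u])].
Proof.
move=> _ Erefl flsc glsc fBC gBC wd fw gdom.
have a1 (x : E) (phi : E -> R) : in_dual phi ->
    exists (y : E) (psi : E -> R) (z : E) (chi : E -> R),
      [/\ Pq f y psi, Pq g z chi, y - z = x & forall u, psi u + chi u = phi u].
  move=> phid.
  (* With s = 1 the second point is (y - x, phi - psi). *)
  have [y [psi [fy gz]]] := Pq_difference (-x) Erefl flsc glsc fBC gBC wd fw gdom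
    (mulr1 1) phid.
  exists y, psi, (1 *: y - x), (fun u => phi u - 1 * psi u); split => //.
    by rewrite scale1r opprB addrC subrK.
  by move=> u; rewrite mul1r addrC subrK.
have m11 : -1 * -1 = 1 :> R by rewrite mulrNN mulr1.
have a2 (x : E) (phi : E -> R) : in_dual phi ->
    exists (y : E) (psi : E -> R) (z : E) (chi : E -> R),
      [/\ Pq f y psi, Pq g z chi, y + z = x & forall u, psi u - chi u = phi u].
  move=> phid.
  (* With s = -1 and the functional - phi the second point is (x - y, psi - phi). *)
  have [y [psi [fy gz]]] := Pq_difference x Erefl flsc glsc fBC gBC wd fw gdom
    m11 (in_dualN phid).
  exists y, psi, (-1 *: y + x), (fun u => - phi u - -1 * psi u); split => //.
    by rewrite scaleN1r addrC addrAC addNr add0r.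
  by move=> u; rewrite mulN1r opprK; lra.
have d0 : in_dual (fun _ : E => 0 : R) := dualP (0 : dual E).
split => //.
(* Prescribing the functional 0 forces psi = chi. *)
- move=> x; have [y [psi [z [chi [fy gz yz e]]]]] := a2 x _ d0.
  exists y, z, psi; split => //.
  by rewrite (_ : psi = chi)//; apply/funext => u; apply/eqP; rewrite -subr_eq0 e.
(* Prescribing the vector 0 forces y = z. *)
- move=> phi phid; have [y [psi [z [chi [fy gz yz e]]]]] := a1 0 _ phid.
  exists y, psi, chi; split => //.
  by move/eqP: yz; rewrite subr_eq0 => /eqP ->.
Qed.
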